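(* Let $\mathcal V_3$ be the variety generated by all semirings of order three, and let $\mathcal A_3$ be the variety generated by all ai-semirings of order three. For all semiring terms $u,q$, \[ \mathcal A_3\models u+q\approx u \quad\Longleftrightarrow\quad \mathcal V_3\models 6u+6q+6u\approx 6u . \]
   Context: A semiring is a nonempty algebra $(S,+,\cdot)$ in the signature of two binary operations (no constants) in which both operations are associative and multiplication distributes over addition on both sides; neither addition nor multiplication is assumed commutative. An ai-semiring is a semiring whose addition is both commutative and idempotent ($x+x=x$); its multiplication need not be commutative. The variety generated by a class of algebras is the smallest class containing it closed under homomorphic images, subalgebras and arbitrary direct products. $\mathcal V\models s\approx t$ means that the identity $s\approx t$ holds in every member of $\mathcal V$. For $m\ge 1$, $mt$ denotes the sum $t+\cdots+t$ of $m$ copies of $t$. *)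

(* Defs.v *)
From Stdlib Require ClassicalEpsilon.
From mathcomp Require Import all_boot.
Set Implicit Arguments.
Unset Strict Implicit.
Unset Printing Implicit Defensive.

(* Algebras in the signature {+, .}: nonemptiness is a property, so no element
   is distinguished and homomorphisms only have to respect the operations. *)
Record algebra : Type := Algebra {
  carrier :> Type;
  nonempty : inhabited carrier;
  add : carrier -> carrier -> carrier;
  mul : carrier -> carrier -> carrier
}.

Definition is_semiring (A : algebra) : Prop :=
  [/\ associative (@add A),
      associative (@mul A),
      left_distributive (@mul A) (@add A)
    & right_distributive (@mul A) (@add A)].

Definition is_ai_semiring (A : algebra) : Prop :=
  [/\ is_semiring A, commutative (@add A) & forall x : A, add x x = x].

Definition order_three (A : algebra) : Prop :=
  exists f : 'I_3 -> A, bijective f.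

Definition is_hom (A B : algebra) (f : A -> B) : Prop :=
  (forall x y, f (add x y) = add (f x) (f y)) /\
  (forall x y, f (mul x y) = mul (f x) (f y)).

Definition closed_op (T : Type) (P : T -> Prop) (op : T -> T -> T) : Prop :=
  forall x y, P x -> P y -> P (op x y).

Definition sub_op (T : Type) (P : T -> Prop) (op : T -> T -> T)
    (clP : closed_op P op) (x y : {z | P z}) : {z | P z} :=
  exist P (op (sval x) (sval y)) (clP _ _ (proj2_sig x) (proj2_sig y)).

Definition subalgebra (A : algebra) (P : A -> Prop)
    (neP : inhabited {x | P x})
    (addP : closed_op P (@add A)) (mulP : closed_op P (@mul A)) : algebra :=
  Algebra neP (sub_op addP) (sub_op mulP).

Lemma product_nonempty (I : Type) (A : I -> algebra) :
  inhabited (forall i, A i).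
Proof.
constructor=> i.
exact: (ClassicalEpsilon.epsilon (nonempty (A i)) (fun _ => True)).
Qed.

Definition product (I : Type) (A : I -> algebra) : algebra :=
  Algebra (product_nonempty A)
    (fun x y i => add (x i) (y i)) (fun x y i => mul (x i) (y i)).

Definition closed_under_homomorphic_images (C : algebra -> Prop) : Prop :=
  forall (A B : algebra) (f : A -> B),
    is_hom f -> (forall y, exists x, f x = y) -> C A -> C B.

Definition closed_under_subalgebras (C : algebra -> Prop) : Prop :=
  forall (A : algebra) (P : A -> Prop) (neP : inhabited {x | P x})
    (addP : closed_op P (@add A)) (mulP : closed_op P (@mul A)),
    C A -> C (subalgebra neP addP mulP).

Definition closed_under_products (C : algebra -> Prop) : Prop :=
  forall (I : Type) (A : I -> algebra), (forall i, C (A i)) -> C (product A).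

Definition is_variety (C : algebra -> Prop) : Prop :=
  [/\ closed_under_homomorphic_images C,
      closed_under_subalgebras C
    & closed_under_products C].

Definition variety_generated (K : algebra -> Prop) : algebra -> Prop :=
  fun A => forall C : algebra -> Prop,
    is_variety C -> (forall B, K B -> C B) -> C A.

Definition V3 : algebra -> Prop :=
  variety_generated (fun A => is_semiring A /\ order_three A).

Definition A3 : algebra -> Prop :=
  variety_generated (fun A => is_ai_semiring A /\ order_three A).

Inductive term : Type :=
  | Var of nat
  | Add of term & term
  | Mul of term & term.

Fixpoint eval (A : algebra) (v : nat -> A) (t : term) : A :=
  match t with
  | Var n => v n
  | Add s t => add (eval v s) (eval v t)
  | Mul s t => mul (eval v s) (eval v t)
  end.

Definition satisfies (A : algebra) (s t : term) : Prop :=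
  forall v : nat -> A, eval v s = eval v t.

Definition models (V : algebra -> Prop) (s t : term) : Prop :=
  forall A : algebra, V A -> satisfies A s t.

(* t + (t + ... + t) with m copies of t; only meaningful for 0 < m, since the
   signature has no zero (the value at m = 0 is t). *)
Definition nsum (m : nat) (t : term) : term := iterop m Add t t.

(* Main.v *)
Require Import Defs.
From Stdlib Require Import ClassicalEpsilon FunctionalExtensionality.
From mathcomp Require Import all_boot.
Set Implicit Arguments.
Unset Strict Implicit.
Unset Printing Implicit Defensive.

(* Let S be a semiring of order three.  A finite check on the associative
   operations on three points shows that x |-> 6x is additive and has additively
   idempotent values (6 is at least the index and a multiple of the period of
   every element); by distributivity it is then an endomorphism of S, whose
   image is an additive band.  By the Clifford-McLean argument, the relation
   "x + y + x = x and y + x + y = y" is a congruence on that band with an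
   ai-semiring as quotient.  This quotient has at most three elements, so after
   adjoining zeros it embeds in an ai-semiring of order three and satisfies
   u + q = u.  Hence 6u + 6q is equivalent to 6u, that is, 6u + 6q + 6u = 6u. *)

(** * Identities in generated varieties *)

Lemma eval_hom (A B : algebra) (f : A -> B) (v : nat -> A) (t : term) :
  is_hom f -> f (eval v t) = eval (fun n => f (v n)) t.
Proof.
by case=> fD fM; elim: t => [//|s IHs t IHt|s IHs t IHt] /=;
   rewrite ?fD ?fM IHs IHt.
Qed.

Lemma satisfies_inj (A B : algebra) (f : A -> B) (s t : term) :
  is_hom f -> injective f -> satisfies B s t -> satisfies A s t.
Proof. by move=> fhom finj Bst v; apply: finj; rewrite !eval_hom. Qed.

(** The easy half of Birkhoff's theorem; it reduces both sides of the equivalence to the generating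
    algebras. *)
Lemma satisfies_variety (s t : term) : is_variety (fun A => satisfies A s t).
Proof.
split.
- move=> A B f fhom fsurj Ast v.
  pose w n := sval (constructive_indefinite_description _ (fsurj (v n))).
  have -> : v = fun n => f (w n).
    apply: functional_extensionality => n.
    exact/esym/(proj2_sig (constructive_indefinite_description _ (fsurj (v n)))).
  by rewrite -!eval_hom // Ast.
- move=> A P neP addP mulP.
  apply: (@satisfies_inj (subalgebra neP addP mulP) A sval) => //.
  move=> [x px] [y py] /= exy; rewrite {x}exy in px *.
  by rewrite (Classical_Prop.proof_irrelevance _ px py).
- move=> I A Ast v; apply: functional_extensionality_dep => i.
  have pr_hom : @is_hom (product A) (A i) (fun x => x i) by [].
  by rewrite !(eval_hom v _ pr_hom) Ast.
Qed.

Lemma models_generated (K : algebra -> Prop) (s t : term) :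
  models (variety_generated K) s t <-> forall A, K A -> satisfies A s t.
Proof.
split=> [Kst A KA | Kst A]; first by apply: Kst => C _; apply.
by move/(_ _ (satisfies_variety s t)); apply.
Qed.

(** * Zeros and ai-semirings with at most three elements *)

Definition adjoin_add (T : Type) (ad : T -> T -> T) (x y : option T) :=
  match x, y with
  | Some a, Some b => Some (ad a b)
  | Some a, None => Some a
  | None, _ => y
  end.

Definition adjoin_mul (T : Type) (mu : T -> T -> T) (x y : option T) :=
  match x, y with
  | Some a, Some b => Some (mu a b)
  | _, _ => None
  end.

Definition adjoin_zero (A : algebra) : algebra :=
  Algebra (inhabits None) (adjoin_add (@add A)) (adjoin_mul (@Defs.mul A)).

Lemma adjoin_zero_ai (A : algebra) :
  is_ai_semiring A -> is_ai_semiring (adjoin_zero A).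
Proof.
case=> -[addA mulA mulDl mulDr] addC addxx; split; first split.
- by move=> [x|] [y|] [z|] //=; rewrite addA.
- by move=> [x|] [y|] [z|] //=; rewrite mulA.
- by move=> [x|] [y|] [z|] //=; rewrite mulDl.
- by move=> [x|] [y|] [z|] //=; rewrite mulDr.
- by move=> [x|] [y|] //=; rewrite addC.
- by move=> [x|] //=; rewrite addxx.
Qed.

(** Induction on the number of missing elements: adjoining a zero adds one element, and identities
    pass down along the embedding [Some]. *)
Lemma small_ai_satisfies (s t : term) :
    (forall A, is_ai_semiring A /\ order_three A -> satisfies A s t) ->
  forall (T : finType) (ne : inhabited T) (ad mu : T -> T -> T),
    #|T| <= 3 -> is_ai_semiring (Algebra ne ad mu) ->
  satisfies (Algebra ne ad mu) s t.
Proof.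
move=> A3st T ne ad mu leT.
have [n] : {n | n + #|T| = 3} by exists (3 - #|T|); rewrite subnK.
elim: n T ne ad mu {leT} => [|n IHn] T ne ad mu cardT aiT.
  apply: A3st; split=> //; exists (fun i => enum_val (cast_ord (esym cardT) i)).
  exists (fun x => cast_ord cardT (enum_rank x)) => x.
    by rewrite enum_valK cast_ordKV.
  by rewrite cast_ordK enum_rankK.
apply: (@satisfies_inj _ (adjoin_zero (Algebra ne ad mu)) Some).
- by split.
- exact: Some_inj.
- apply: (IHn (option T) (inhabits None) (adjoin_add ad) (adjoin_mul mu)).
    by rewrite card_option addnS -addSn.
  exact: (adjoin_zero_ai aiT).
Qed.

(** * Quotients realised as images of retractions *)

Lemma is_semiring_image (A B : algebra) (f : A -> B) :
  is_hom f -> (forall y, exists x, f x = y) -> is_semiring A -> is_semiring B.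
Proof.
move=> [fD fM] fsurj [addA mulA mulDl mulDr]; split=> x y z;
  have [a <-] := fsurj x; have [b <-] := fsurj y; have [c <-] := fsurj z;
  by rewrite -!(fD, fM) (addA, mulA, mulDl, mulDr).
Qed.

(** The quotient by the kernel of [r], carried by the fixed points of [r]. It serves twice: for the
    choice of class representatives and for x |-> 6x. *)
Lemma retract_image (T : finType) (ne : inhabited T) (ad mu : T -> T -> T)
    (r : T -> T) :
    (forall x, r (r x) = r x) ->
    (forall x y, r (ad (r x) (r y)) = r (ad x y)) ->
    (forall x y, r (mu (r x) (r y)) = r (mu x y)) ->
  exists (Q : finType) (neQ : inhabited Q) (adQ muQ : Q -> Q -> Q)
      (h : Algebra ne ad mu -> Algebra neQ adQ muQ),
    [/\ is_hom h, forall y, exists x, h x = y,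
        forall x y, h x = h y <-> r x = r y & #|Q| <= #|T|].
Proof.
move=> rr rD rM; have rrb x : r (r x) == r x by apply/eqP.
pose Q := {x : T | r x == x}; pose h x : Q := exist _ (r x) (rrb x).
have neQ : inhabited Q by case: ne => x; exact: inhabits (h x).
exists Q, neQ, (fun x y => h (ad (val x) (val y))),
  (fun x y => h (mu (val x) (val y))), h; split.
- by split=> x y; apply: val_inj; rewrite /= ?rD ?rM.
- by move=> y; exists (val y); apply: val_inj; apply/eqP; exact: (valP y).
- by move=> x y; split=> [/(congr1 val) | rxy] //; exact: val_inj.
- by rewrite card_sig; exact: max_card.
Qed.

Lemma quotient_ai_satisfies (s t : term) (T : finType) (ne : inhabited T)
    (ad mu : T -> T -> T) (e : rel T) :
    (forall A, is_ai_semiring A /\ order_three A -> satisfies A s t) ->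
    #|T| <= 3 -> is_semiring (Algebra ne ad mu) ->
    equivalence_rel e ->
    (forall x x' y y', e x x' -> e y y' -> e (ad x y) (ad x' y')) ->
    (forall x x' y y', e x x' -> e y y' -> e (mu x y) (mu x' y')) ->
    (forall x y, e (ad x y) (ad y x)) -> (forall x, e (ad x x) x) ->
  forall v : nat -> Algebra ne ad mu, e (eval v s) (eval v t).
Proof.
move=> A3st leT semiT eqe eD eM eC eI v.
have exx x : e x x by have [] := eqe x x x.
have etr x y z : e x y -> e x z = e y z by have [_] := eqe x y z.
have esy x y : e x y = e y x.
  by apply/idP/idP => exy; rewrite -(etr _ _ _ exy).
(* Equivalent elements have the same class, hence the same chosen representative, so [e] is the
   kernel of [r]. *)
pose r x := choose (e x) x.
have er x : e x (r x) by apply: chooseP.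
have r_eq x y : e x y -> r x = r y.
  move=> exy; rewrite /r (@eq_choose _ (e x) (e y)); last by move=> z; exact: etr.
  by apply: choose_id; rewrite // esy.
have re x : e (r x) x by rewrite esy.
have [||| Q [neQ [adQ [muQ [h [h_hom h_surj hE leQ]]]]]] :=
  @retract_image T ne ad mu r.
- by move=> x; exact: r_eq.
- by move=> x y; apply: r_eq; exact: eD.
- by move=> x y; apply: r_eq; exact: eM.
have [hD _] := h_hom.
have aiQ : is_ai_semiring (Algebra neQ adQ muQ).
  split; first exact: is_semiring_image h_hom h_surj semiT.
    move=> x y; have [a <-] := h_surj x; have [b <-] := h_surj y.
    by rewrite -!hD; apply/hE/r_eq; exact: eC.
  by move=> x; have [a <-] := h_surj x; rewrite -hD; apply/hE/r_eq; exact: eI.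
have /hE eq_r : h (eval v s) = h (eval v t).
  rewrite !(eval_hom v _ h_hom).
  by apply: (small_ai_satisfies A3st) => //; exact: leq_trans leT.
by rewrite (etr _ _ _ (er _)) eq_r.
Qed.

(** * The Clifford-McLean preorder on a band *)

Section Band.

Variables (T : Type) (op : T -> T -> T).
Hypotheses (opA : associative op) (opI : forall x, op x x = x).

Definition band_le (x y : T) := op (op x y) x = x.

(** If x = ayb then xyb = a(yb)(yb) = x, so xyx = (xy)(xy)b = xyb = x. Thus [band_le x y] says that
    x lies in the ideal generated by y. *)
Lemma band_le_factor (a x y b : T) : x = op (op a y) b -> band_le x y.
Proof.
move=> defx; have xyb : op (op x y) b = x.
  by rewrite {1}defx -!opA (opA y b) opI opA.
by rewrite /band_le -{2}xyb opA opI.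
Qed.

Lemma band_le_trans (x y z : T) : band_le x y -> band_le y z -> band_le x z.
Proof.
move=> xy yz; apply: (@band_le_factor (op x y) _ _ (op y x)).
rewrite -{1}xy -{1}yz; rewrite /band_le in xy yz; by rewrite !opA.
Qed.

Lemma band_le_opC (x y : T) : band_le (op x y) (op y x).
Proof. by apply: (@band_le_factor x _ _ y); rewrite !opA -opA opI. Qed.

Lemma band_le_opr (x y : T) : band_le (op x y) y.
Proof. by apply: (@band_le_factor x _ _ y); rewrite -opA opI. Qed.

(** The chain is zx <= zxy <= xyz <= yz <= zy; its first link holds because zx = (zx)(zxy)x when xyx
    = x. *)
Lemma band_le_op2l (x y z : T) : band_le x y -> band_le (op z x) (op z y).
Proof.
move=> xy; apply: (@band_le_trans _ (op z (op x y))).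
  by apply: (@band_le_factor (op z x) _ _ x); rewrite -opA -(opA z (op x y)) xy opI.
apply: band_le_trans (band_le_opC _ _) _; rewrite -opA.
exact: band_le_trans (band_le_opr _ _) (band_le_opC _ _).
Qed.

Lemma band_le_op2 (x x' y y' : T) :
  band_le x x' -> band_le y y' -> band_le (op x y) (op x' y').
Proof.
move=> xx' yy'; apply: band_le_trans (band_le_op2l _ yy').
apply: band_le_trans (band_le_opC _ _) _.
exact: band_le_trans (band_le_op2l _ xx') (band_le_opC _ _).
Qed.

End Band.

(** * The map x |-> 6x on three points *)

Definition six (T : Type) (op : T -> T -> T) (x : T) := iterop 6 op x x.

(* Operations on three points are tabulated over nat: the enumeration of 'I_3 is
   locked and would not reduce under vm_compute. *)
Definition row3 (A : Type) (a b c : A) (i : nat) :=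
  match i with 0 => a | 1 => b | _ => c end.

Definition all_three (p : nat -> bool) := [&& p 0, p 1 & p 2].

Lemma all_threeP (p : nat -> bool) :
  reflect (forall i : 'I_3, p i) (all_three p).
Proof.
apply: (iffP and3P) => [[p0 p1 p2] [[|[|[|]]]] // | pI].
by split; [apply: (pI (@Ordinal 3 0 _)) | apply: (pI (@Ordinal 3 1 _))
         | apply: (pI (@Ordinal 3 2 _))].
Qed.

Definition six_test (op : nat -> nat -> nat) :=
  all_three (fun x => all_three (fun y => all_three (fun z =>
    op x (op y z) == op (op x y) z))) ==>
  all_three (fun x => (op (six op x) (six op x) == six op x) &&
    all_three (fun y => six op (op x y) == op (six op x) (six op y))).

(** Exhaustive check of all 3^9 operation tables. *)
Lemma six_testP :
  all_three (fun a => all_three (fun b => all_three (fun c =>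
  all_three (fun d => all_three (fun e => all_three (fun f =>
  all_three (fun g => all_three (fun h => all_three (fun i =>
    six_test (row3 (row3 a b c) (row3 d e f) (row3 g h i))))))))))).
Proof. by vm_compute. Qed.

Lemma six_order_three (op : 'I_3 -> 'I_3 -> 'I_3) : associative op ->
  (forall x, op (six op x) (six op x) = six op x) /\
  {morph six op : x y / op x y}.
Proof.
move=> opA; pose e k : 'I_3 := inord k.
have := six_testP.
(* The check is instantiated at the nine entries of the table of [op], row by row. *)
move=> /all_threeP/(_ (op (e 0) (e 0)))/all_threeP/(_ (op (e 0) (e 1))).
move=> /all_threeP/(_ (op (e 0) (e 2)))/all_threeP/(_ (op (e 1) (e 0))).
move=> /all_threeP/(_ (op (e 1) (e 1)))/all_threeP/(_ (op (e 1) (e 2))).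
move=> /all_threeP/(_ (op (e 2) (e 0)))/all_threeP/(_ (op (e 2) (e 1))).
move=> /all_threeP/(_ (op (e 2) (e 2))); set o := row3 _ _ _.
have oE (i j : 'I_3) : o i j = op i j.
  rewrite -[in RHS](inord_val i) -[in RHS](inord_val j).
  by case: i => [[|[|[|]]] //= _]; case: j => [[|[|[|]]] //= _].
have sixE (i : 'I_3) : six o i = six op i by rewrite /six /= !oE.
have o_assoc : all_three (fun x => all_three (fun y => all_three (fun z =>
    o x (o y z) == o (o x y) z))).
  by do 3!apply/all_threeP => ?; rewrite !oE opA.
move=> /implyP/(_ o_assoc)/all_threeP test.
split=> [x | x y]; apply: val_inj; apply/eqP; have /andP[] := test x.
  by rewrite !(sixE, oE).
by move=> _ /all_threeP/(_ y); rewrite !(sixE, oE).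
Qed.

Section Six.

Variable A : algebra.
Hypotheses (semiringA : is_semiring A).

Let p : A -> A := six (@add A).
Hypothesis six_idem : forall x, add (p x) (p x) = p x.

(** By distributivity (6a)(6b) = 6(6(ab)), and 6(ab) is additively idempotent. *)
Lemma six_mul : {morph p : x y / Defs.mul x y}.
Proof.
have [addA mulA mulDl mulDr] := semiringA => x y.
have pl a b : Defs.mul (p a) b = p (Defs.mul a b) by rewrite /p /six /= !mulDl.
have pr a b : Defs.mul a (p b) = p (Defs.mul a b) by rewrite /p /six /= !mulDr.
have pp a : p (p a) = p a by rewrite {1}/p /six /= !six_idem.
by rewrite pl pr pp.
Qed.

End Six.

(** * From additive bands to all semirings of order three *)

Lemma idempotent_semiring_satisfies (u q : term) (T : finType)
    (ne : inhabited T) (ad mu : T -> T -> T) :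
    (forall A, is_ai_semiring A /\ order_three A -> satisfies A (Add u q) u) ->
    #|T| <= 3 -> is_semiring (Algebra ne ad mu) -> (forall x, ad x x = x) ->
  satisfies (Algebra ne ad mu) (Add (Add u q) u) u.
Proof.
move=> A3uq leT semiT adI v; have [/= adA _ muDl muDr] := semiT.
pose le x y := ad (ad x y) x == x.
pose e x y := le x y && le y x.
have le_trans x y z : le x y -> le y z -> le x z.
  by move=> /eqP xy /eqP yz; apply/eqP; exact: (band_le_trans adA adI xy yz).
have le_ad x x' y y' : le x x' -> le y y' -> le (ad x y) (ad x' y').
  by move=> /eqP xx' /eqP yy'; apply/eqP; exact: (band_le_op2 adA adI xx' yy').
(* Multiplication by a fixed element is additive, so it preserves [le]; one factor is changed at a
   time. *)
have le_mu x x' y y' : le x x' -> le y y' -> le (mu x y) (mu x' y').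
  move=> /eqP xx' /eqP yy'; apply: (le_trans _ (mu x y')); apply/eqP.
    by rewrite -!muDr yy'.
  by rewrite -!muDl xx'.
have le_refl x : le x x by rewrite /le !adI.
have : e (@eval (Algebra ne ad mu) v (Add u q)) (@eval (Algebra ne ad mu) v u).
  apply: quotient_ai_satisfies => //.
  - move=> x y z; split=> [|/andP[xy yx]]; first by rewrite /e le_refl.
    by apply/idP/idP => /andP[? ?]; apply/andP; split; eauto.
  - by move=> x x' y y' /andP[? ?] /andP[? ?]; apply/andP; split; apply: le_ad.
  - by move=> x x' y y' /andP[? ?] /andP[? ?]; apply/andP; split; apply: le_mu.
  - by move=> x y; apply/andP; split; apply/eqP; exact: band_le_opC.
  - by move=> x; rewrite adI /e le_refl.
(* The half [le u (u + q)] of the equivalence reads u + (u + q) + u = u. *)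
by case/andP=> _ /eqP /=; rewrite !adA adI.
Qed.

Lemma order_three_satisfies (u q : term) (A : algebra) :
    (forall B, is_ai_semiring B /\ order_three B -> satisfies B (Add u q) u) ->
    is_semiring A -> order_three A ->
  satisfies A (Add (Add (nsum 6 u) (nsum 6 q)) (nsum 6 u)) (nsum 6 u).
Proof.
move=> A3uq semiringA [f [g fK gK]].
(* The structure is transported to ['I_3], where the finite check applies. *)
pose ad x y := g (add (f x) (f y)); pose mu x y := g (Defs.mul (f x) (f y)).
pose B := Algebra (inhabits ord0) ad mu.
have g_hom : @is_hom A B g by split=> x y; rewrite /= /ad /mu !gK.
apply: (satisfies_inj g_hom (can_inj gK)).
have semiringB : is_semiring B.
  by apply: (is_semiring_image g_hom) => // y; exists (f y).
have [adA _ _ _] := semiringB.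
have [six_idem sixD] := @six_order_three ad adA.
have sixM : {morph six ad : x y / mu x y} by exact: (six_mul semiringB).
have six_six x : six ad (six ad x) = six ad x by rewrite {1}/six /= !six_idem.
have [||| E [neE [adE [muE [h [h_hom h_surj hE leE]]]]]] :=
  @retract_image 'I_3 (inhabits ord0) ad mu (six ad).
- exact: six_six.
- by move=> x y; rewrite [LHS]sixD !six_six [RHS]sixD.
- by move=> x y; rewrite !sixM !six_six.
have semiringE := is_semiring_image h_hom h_surj semiringB.
have adEI x : adE x x = x.
  have [hD _] := h_hom; have [a <-] := h_surj x.
  by rewrite -[LHS]hD; apply/hE; rewrite sixD six_idem.
have Euq : satisfies (Algebra neE adE muE) (Add (Add u q) u) u.
  by apply: idempotent_semiring_satisfies => //; rewrite -[3]card_ord.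
(* Since [h] has the same kernel as x |-> 6x, this gives 6(u + q + u) = 6u, and additivity splits
   the left side. *)
move=> v; have /hE : h (@eval B v (Add (Add u q) u)) = h (@eval B v u).
  by rewrite !(eval_hom v _ h_hom).
by rewrite /= !sixD.
Qed.

Theorem proposition7p3 (u q : term) :
  models A3 (Add u q) u <->
  models V3 (Add (Add (nsum 6 u) (nsum 6 q)) (nsum 6 u)) (nsum 6 u).
Proof.
split=> /models_generated uq; apply/models_generated.
  by move=> A [semiA A3]; exact: order_three_satisfies.
(* In an ai-semiring 6t = t, so the identity becomes u + q + u = u, and its left side equals u +
   q. *)
move=> A [[semiA addC addxx] A3] v; have := uq A (conj semiA A3) v.
have [addA _ _ _] := semiA.
by rewrite /= !addxx [LHS]addC addA addxx.
Qed.
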